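(* Let $a,b,c$ be positive integers and let $\mathsf{B}_{a,b,c} = \mathbf{a}\times\mathbf{b}\times\mathbf{c}$ be the product of chains with $a$, $b$ and $c$ elements. Let $k$ be the cardinality of any $\Psi$-orbit of $J(\mathsf{B}_{a,b,c})$, where $\Psi$ is rowmotion. Then \[ \gcd(k,\, a+b+c-1) > 1. \]
   Context: For a finite poset $\mathsf{P}$, $J(\mathsf{P})$ denotes the set of order ideals of $\mathsf{P}$. Rowmotion $\Psi : J(\mathsf{P}) \to J(\mathsf{P})$ sends an order ideal $I$ to the order ideal generated by the minimal elements of the complementary order filter $\mathsf{P} - I$; it is a bijection, so $J(\mathsf{P})$ decomposes into $\Psi$-orbits. Here $\mathbf{n}$ denotes the chain $1<2<\dots<n$, and $\mathsf{B}_{a,b,c}$ carries the product order (its order ideals are the plane partitions in an $a\times b\times c$ box). *)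

(* Defs.v *)
From HB Require Import structures.
From mathcomp Require Import all_boot all_order.

Set Implicit Arguments.
Unset Strict Implicit.
Unset Printing Implicit Defensive.

Import Order.TTheory.

Section Rowmotion.

Context {d : Order.disp_t} (P : finPOrderType d).
Implicit Types (x y : P) (A : {set P}).

Definition is_order_ideal A : bool :=
  [forall x in A, forall y, (y <= x)%O ==> (y \in A)].

Record order_ideal := OrderIdeal {
  ideal_set :> {set P};
  ideal_setP : is_order_ideal ideal_set }.

HB.instance Definition _ := [isSub for ideal_set].
HB.instance Definition _ := [Finite of order_ideal by <:].

Definition minimal_elements A : {set P} :=
  [set x in A | [forall y in A, ~~ (y < x)%O]].

Definition down_closure A : {set P} :=
  [set x | [exists y in A, (x <= y)%O]].

Lemma down_closure_ideal A : is_order_ideal (down_closure A).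
Proof.
apply/forall_inP => x; rewrite inE => /exists_inP[z zA xz].
apply/forallP => y; apply/implyP => yx; rewrite inE.
by apply/exists_inP; exists z => //; apply: le_trans xz.
Qed.

Definition generated_ideal A : order_ideal :=
  OrderIdeal (down_closure_ideal A).

Definition rowmotion (I : order_ideal) : order_ideal :=
  generated_ideal (minimal_elements (~: I)).

(* Since rowmotion is injective on a finite type, its forward orbits, as given
   by orbit in fingraph.v, are its full orbits. *)
Lemma rowmotion_inj : injective rowmotion.
Proof.
move=> I J E. apply: val_inj => /=.
have key (K : order_ideal) x : (x \in minimal_elements (~: K)) = (x \in (rowmotion K)) && [forall y in rowmotion K, ~~ (x < y)%O].
  have anti z w : z \in minimal_elements (~: K) -> w \in minimal_elements (~: K) -> ~~ (z < w)%O.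
    by rewrite !inE => /andP[zK _] /andP[_ /forall_inP h]; apply: h; rewrite inE.
  apply/idP/andP.
    move=> xm; split; first by rewrite inE; apply/exists_inP; exists x.
    apply/forall_inP => y; rewrite inE => /exists_inP[z zm yz]; apply/negP => xy.
    by move: (anti _ _ xm zm); rewrite (lt_le_trans xy yz).
  rewrite inE => -[/exists_inP[z zm xz] /forall_inP h].
  move: xz; rewrite le_eqVlt => /orP[/eqP-> //|xz].
  suff /h : z \in rowmotion K by rewrite xz.
  by rewrite inE; apply/exists_inP; exists z.
have sub (K L : order_ideal) : rowmotion K = rowmotion L -> ideal_set K \subset L.
  move=> e; apply/subsetP => x xK; apply/negPn/negP => xL.
  have [z zL zmin] := @arg_minnP _ x (fun z => (z <= x)%O && (z \notin (L : {set P}))) (fun z => #|[set w | (w <= z)%O]|) ltac:(by move=> /=; rewrite lexx xL).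
  case/andP: zL => zx zL.
  have : z \in minimal_elements (~: L).
    rewrite !inE zL; apply/forall_inP => y; rewrite inE => yL; apply/negP => yz.
    have := zmin y; rewrite (le_trans (ltW yz) zx) yL => /(_ isT); rewrite leqNgt => /negP; apply.
    apply: proper_card; apply/properP; split.
      by apply/subsetP => w; rewrite !inE => /le_trans; apply; apply: ltW.
    by exists z; rewrite !inE ?lexx ?lt_geF.
  rewrite key -e -key !inE.
  by have /forall_inP /(_ _ xK) /forallP /(_ z) := ideal_setP K; rewrite zx /= => ->.
by apply/eqP; rewrite eqEsubset !sub.
Qed.

End Rowmotion.

Notation "'J(' P )" := (order_ideal P) (at level 0, format "'J(' P )").

(* 'I_n is the chain 0 < ... < n - 1, isomorphic to 1 < ... < n; *p is the
   product with the componentwise (not lexicographic) order. *)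
Notation box a b c := ('I_a *p 'I_b *p 'I_c)%type.

(* Main.v *)
(** Record the whole orbit by f(N, p) = [p lies in the N-th iterate]. Rowmotion
    is then a local rule in spacetime. In suitable coordinates it is the growth
    rule of K-theoretic jeu de taquin: the orbit is a diagram of partitions
    L(s, M) inside the a x b rectangle, decreasing in s and increasing in M,
    with L(s, s) empty and L(s, s + q) full for q = a + b + c - 1.

    The length of the longest increasing chain of boxes does not decrease under
    a K-jeu de taquin slide. This gives the Weyl-type inequality
    L(n, M)_a <= L(n, m)_1 + L(m, M)_a between first and last rows. For
    M = n + q it says that a point of the face x = 0 and its antipode cannot
    both be outside at times that differ by a known delay. The local rule has
    two symmetries. Exchanging an ideal with the antipode of its complement,
    backwards in time, turns this into a reciprocity between the faces x = 0
    and x = a - 1; reversing time with a shift by rank gives a second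
    reciprocity with the complementary delay. Together they show that the face
    x = 0 is q-periodic in time. If the orbit length were prime to q, that face
    would be constant in time, hence always full; by reciprocity the corner
    (a - 1, 0, 0) would be always empty, and the local rule propagates this
    emptiness to the full corner (0, 0, 0). *)
Require Import Defs.
From mathcomp Require Import all_boot all_order all_algebra.
From mathcomp Require Import zify.

Set Implicit Arguments.
Unset Strict Implicit.
Unset Printing Implicit Defensive.

Import Order.TTheory GRing.Theory Num.Theory.

(** [P] holds on an initial segment, whose length is the count. *)
Lemma count_antitone (P : pred nat) k y :
  (forall i, i.+1 < k -> P i.+1 -> P i) ->
  (y < count P (iota 0 k)) = (y < k) && P y.
Proof.
elim: k => [|k IHk] Pdec //.
have -> : iota 0 k.+1 = iota 0 k ++ [:: k] by rewrite -addn1 iotaD.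
rewrite count_cat /= addn0.
have {}IHk := IHk (fun i ik => Pdec i (ltnW ik)).
have [Pk|nPk] := boolP (P k); last first.
  rewrite addn0 IHk ltnS (leq_eqVlt y).
  by case: eqVneq => [->|]//=; rewrite ltnn (negPf nPk).
have Pall j : j <= k -> P (k - j).
  elim: j => [|j IHj] jk; first by rewrite subn0.
  by apply: Pdec; rewrite subnSK ?IHj; lia.
suff -> : count P (iota 0 k) = k.
  rewrite addn1 ltnS; case: leqP => //= yk.
  by rewrite -(subKn yk) Pall //; lia.
rewrite -[RHS](size_iota 0); apply/eqP; rewrite -all_count.
apply/allP => i; rewrite mem_iota => ik.
by rewrite -(subKn (_ : i <= k)%N) ?Pall //; lia.
Qed.

(** * Spacetimes and their growth diagrams: row lengths and bullets *)

Section Spacetime.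

Variables a b c : nat.
Local Open Scope ring_scope.
Implicit Types (f : int -> nat -> nat -> int -> bool) (N s t n m M z : int).

Definition covers (x y : nat) z (x' y' : nat) z' : Prop :=
  x' = x.+1 /\ y' = y /\ z' = z \/ x' = x /\ y' = y.+1 /\ z' = z \/
  x' = x /\ y' = y /\ z' = z + 1.

(* [f N x y z] says that the 0-based point [(x, y, z)] lies in the N-th ideal of
   an orbit; [z] ranges over all integers, with every point below the box inside
   and every point above it outside. *)
Record spacetime f : Prop := Spacetime {
  st_low N x y z : (x < a)%N -> (y < b)%N -> z < 0 -> f N x y z;
  st_high N x y z : (x < a)%N -> (y < b)%N -> c%:Z <= z -> ~~ f N x y z;
  st_down N x y z N' x' y' z' : f N' x' y' z' -> (x' < a)%N -> (y' < b)%N ->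
    covers x y z x' y' z' -> N' = N \/ N' = N + 1 -> f N x y z;
  st_out N x y z : (x < a)%N -> (y < b)%N -> z < c%:Z ->
    ~~ f N x y z -> ~~ f (N + 1) x y z ->
    exists x' y' z', covers x' y' z' x y z /\ ~~ f N x' y' z';
  st_in N x y z : (x < a)%N -> (y < b)%N -> 0 <= z ->
    f N x y z -> f (N + 1) x y z ->
    exists x' y' z', covers x y z x' y' z' /\
      [/\ (x' < a)%N, (y' < b)%N & f (N + 1) x' y' z']
}.

Section Growth.

Variables (f : int -> nat -> nat -> int -> bool).
Hypothesis fP : spacetime f.

(* The box [(x, y)] belongs to the shape [L(s, M)]: the coordinate [z] is read
   off the distance [M - s], and time is skewed by [x + y]. *)
Definition growth s M x y :=
  f (s + x%:Z + y%:Z) x y (x%:Z + y%:Z + c%:Z - (M - s)).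

Definition rowlen s M x := count (growth s M x) (iota 0 b).

Lemma rowlenE s M x y : (x < a)%N ->
  (y < rowlen s M x)%N = (y < b)%N && growth s M x y.
Proof.
move=> xa; apply: count_antitone => i ib fi.
have fi' : f (s + x%:Z + i%:Z + 1) x i (x%:Z + i%:Z + c%:Z - (M - s) + 1).
  by apply: (st_down fP fi xa ib); rewrite /covers; lia.
by apply: (st_down fP fi' xa (ltnW ib)); rewrite /covers; lia.
Qed.

Lemma rowlen_le_size s M x : (rowlen s M x <= b)%N.
Proof. by rewrite -[leqRHS](size_iota 0) count_size. Qed.

Lemma rowlen_le s M x s' M' x' : (x < a)%N -> (x' < a)%N ->
  (forall y, (y < b)%N -> growth s M x y -> growth s' M' x' y) ->
  (rowlen s M x <= rowlen s' M' x')%N.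
Proof.
move=> xa x'a sub; case E: (rowlen s M x) => [|y] //.
have := ltnSn y; rewrite -{2}E !rowlenE // => /andP[yb].
by rewrite yb; apply: sub.
Qed.

Lemma rowlen_leS s M x s' M' x' : (x < a)%N -> (x' < a)%N ->
  (forall y, (y.+1 < b)%N -> growth s M x y.+1 -> growth s' M' x' y) ->
  (rowlen s M x <= (rowlen s' M' x').+1)%N.
Proof.
move=> xa x'a sub; case E: (rowlen s M x) => [|[|y]] //.
have := ltnSn y.+1; rewrite -{2}E ltnS !rowlenE // => /andP[yb].
by rewrite (ltnW yb); apply: sub.
Qed.

Lemma rowlen_incr s M x : (x < a)%N -> (rowlen s M x <= rowlen s (M + 1) x)%N.
Proof.
move=> xa; apply: rowlen_le => // y yb h.
by apply: (st_down fP h); rewrite /covers; lia.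
Qed.

Lemma rowlen_incr1 s M x :
  (x < a)%N -> (rowlen s (M + 1) x <= (rowlen s M x).+1)%N.
Proof.
move=> xa; apply: rowlen_leS => // y yb h.
by apply: (st_down fP h); rewrite /covers; lia.
Qed.

(** With [rowlen_incr1]: consecutive shapes in [M] differ by a rook strip, at most one box in each
    row and column. *)
Lemma rowlen_rook s M x :
  (x.+1 < a)%N -> (rowlen s (M + 1) x.+1 <= rowlen s M x)%N.
Proof.
move=> xa; apply: rowlen_le => // [|y yb h]; first exact: ltnW.
by apply: (st_down fP h); rewrite /covers; lia.
Qed.

Lemma rowlen_row s M x : (x.+1 < a)%N -> (rowlen s M x.+1 <= rowlen s M x)%N.
Proof.
by move=> xa; apply: leq_trans (rowlen_rook _ _ xa); apply: rowlen_incr.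
Qed.

Lemma rowlen_decr s M x : (x < a)%N -> (rowlen (s + 1) M x <= rowlen s M x)%N.
Proof.
move=> xa; apply: rowlen_le => // y yb h.
by apply: (st_down fP h); rewrite /covers; lia.
Qed.

Lemma rowlen_decr1 s M x :
  (x < a)%N -> (rowlen s M x <= (rowlen (s + 1) M x).+1)%N.
Proof.
move=> xa; apply: rowlen_leS => // y yb h.
by apply: (st_down fP h); rewrite /covers; lia.
Qed.

(** From distance [a + b + c - 1] on, every box is read at a height [z < 0]. *)
Lemma rowlen_full s M x :
  (x < a)%N -> (a + b + c <= `|M - s|.+1)%N -> s <= M -> rowlen s M x = b.
Proof.
move=> xa le_q sM; apply/eqP; rewrite eqn_leq rowlen_le_size /= leqNgt.
apply/negP => lt; have : (rowlen s M x < rowlen s M x)%N.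
  by rewrite rowlenE // lt; apply: (st_low fP) => //; lia.
by rewrite ltnn.
Qed.

(* The bullets of the slide from column [M + 1] to column [M]. *)
Definition bullet s M x : int := (rowlen s (M + 1) x)%:Z - (rowlen s M x)%:Z.

Lemma bullet01 s M x : (x < a)%N -> bullet s M x = 0 \/ bullet s M x = 1.
Proof.
move=> xa; have := rowlen_incr s M xa; have := rowlen_incr1 s M xa.
by rewrite /bullet; lia.
Qed.

(* A bullet that is in row [x] at level [s] but not at level [s + 1] came down
   from the row above, into a column where both rows had the same length. *)
Lemma bullet_enters s M x : (x < a)%N -> s + 1 <= M ->
  bullet s M x = 1 -> bullet (s + 1) M x = 0 ->
  exists2 x', x = x'.+1 & rowlen (s + 1) M x' = rowlen (s + 1) M x.
Proof.
rewrite /bullet => xa sM bs bs1.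
have le1 := rowlen_decr s M xa; have le2 := rowlen_decr1 s (M + 1) xa.
set u := rowlen s M x in bs le1.
have {}bs : rowlen s (M + 1) x = u.+1 by lia.
have {}bs1 : rowlen (s + 1) (M + 1) x = rowlen (s + 1) M x by lia.
have eu : rowlen (s + 1) M x = u by lia.
have ub : (u < b)%N by have := rowlen_le_size s (M + 1) x; lia.
have : (u < rowlen s (M + 1) x)%N by rewrite bs.
rewrite rowlenE // => /andP[_ Lu].
have : ~~ (u < rowlen s M x)%N by rewrite ltnn.
rewrite rowlenE // ub => Mu.
have : ~~ (u < rowlen (s + 1) (M + 1) x)%N by rewrite bs1 eu ltnn.
rewrite rowlenE // ub => Ru.
(* The point [(x, u, z)] is outside at [N] and [N + 1]. Its lower neighbours in [y] and [z] are
   inside at [N], so the local rule leaves only the one in row [x - 1]. *)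
pose N := s + x%:Z + u%:Z; pose z := x%:Z + u%:Z + c%:Z - (M - s).
have left y : u = y.+1 -> f N x y z.
  move=> uy; have : (y < rowlen (s + 1) M x)%N by rewrite eu uy.
  rewrite rowlenE // => /andP[_]; rewrite /growth.
  by congr (f _ _ _ _); lia.
suff [x' xx' nf] : exists2 x', x = x'.+1 & ~~ f N x' u z.
  exists x' => //; apply/eqP; rewrite eq_sym eqn_leq {1}xx' rowlen_row -?xx' //=.
  have x'a : (x' < a)%N by rewrite xx' in xa; apply: ltnW.
  rewrite eu leqNgt rowlenE // ub /=; apply: contra nf; rewrite /growth.
  by congr (f _ _ _ _); lia.
have [zc|zc] := ltP z c%:Z.
  have [||x' [y' [z' [cov nf]]]] := st_out fP xa ub zc (N := N) => //.
    apply: contra Ru; rewrite /growth.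
    by congr (f _ _ _ _); lia.
  case: cov nf => [[xx' [<- <-]]|[[<- [uy' <-]]|[<- [<- zz']]]] nf.
  - by exists x'.
  - by rewrite left in nf.
  - case/negP: nf; move: Lu; rewrite /growth.
    by congr (f _ _ _ _); lia.
case E: x => [|x'].
  (* [c <= z] and [s + 1 <= M] exclude [x = u = 0]. *)
  case Eu: u => [|y]; first by rewrite /z E Eu in zc; lia.
  have := left _ Eu; rewrite (negPf (st_high fP _ _ _ zc)) //.
  by apply: leq_ltn_trans ub; rewrite Eu.
by exists x' => //; apply: (st_high fP) => //; rewrite E in xa; apply: ltnW.
Qed.


Lemma bullet_switch s t M x : (x < a)%N -> s <= t ->
  bullet t M x < bullet s M x ->
  exists r, [/\ s <= r, r + 1 <= t, bullet r M x = 1 & bullet (r + 1) M x = 0].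
Proof.
move=> xa st; have [k ->] : exists k : nat, t = s + k%:Z by exists `|t - s|%N; lia.
elim: k => [|k IHk] lt_b; first by rewrite addr0 ltxx in lt_b.
have -> : s + k.+1%:Z = s + k%:Z + 1 by lia.
have bS : bullet (s + k%:Z + 1) M x < bullet s M x.
  by rewrite (_ : s + k%:Z + 1 = s + k.+1%:Z) //; lia.
have [|ge_b] := ltP (bullet (s + k%:Z) M x) (bullet s M x).
  by move/IHk => [r [? ? ? ?]]; exists r; split=> //; lia.
exists (s + k%:Z); have := bullet01 s M xa; have := bullet01 (s + k%:Z) M xa.
by have := bullet01 (s + k%:Z + 1) M xa; split; lia.
Qed.

(** No row lies above row 0 for a bullet to come from. *)
Lemma bullet_row0 s t M :
  (0 < a)%N -> s <= t -> t <= M -> bullet s M 0 <= bullet t M 0.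
Proof.
move=> a0 st tM; rewrite leNgt; apply/negP.
move/(bullet_switch a0 st) => [r [_ rt br br1]].
by have [|x' //] := bullet_enters a0 _ br br1; apply: le_trans tM.
Qed.

(** * Increasing chains and the Weyl-type inequality *)

Definition gap s M x : int := (rowlen s M x)%:Z - (rowlen s M x.+1)%:Z.

(* A chain that loses a box because a bullet entered row [x.+1] can leave that
   row earlier, at the level where the bullet entered: the gap there is 0, and
   it was positive at [s], where the bullet occupied an addable corner. *)
Lemma gap_switch s t M x : (x.+1 < a)%N -> s <= t -> t <= M ->
  exists r, [/\ s <= r, r <= t &
    gap r M x + bullet s M x.+1 <= gap s M x + bullet t M x.+1].
Proof.
move=> xa st tM.
have [lt_b|] := ltP (bullet t M x.+1) (bullet s M x.+1); last first.
  by exists s; split=> //; rewrite lerD2l.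
have [r [sr rt br br1]] := bullet_switch xa st lt_b.
have [|_ [<-] eq_len] := bullet_enters xa _ br br1; first exact: le_trans tM.
exists (r + 1); split; [lia|done|].
have := rowlen_rook s M xa; have := bullet01 s M xa; have := bullet01 t M xa.
by move: lt_b; rewrite /gap eq_len /bullet; lia.
Qed.

(* For levels [n <= t_0 <= ... <= t_(j - 1) <= t], the boxes that row [i < j]
   loses between levels [t_(i - 1)] and [t_i] (where [t_(-1) = n]) form an
   increasing chain; [v] is its size plus the length of row [j] at level
   [t_(j - 1)]. *)
Fixpoint chain n M j (v t : int) : Prop :=
  if j is i.+1 then exists v0 t0, [/\ chain n M i v0 t0, t0 <= t &
    v = v0 - gap t0 M i]
  else v = rowlen n M 0 /\ n <= t.

Lemma chain_le n M j v t t' : t <= t' -> chain n M j v t -> chain n M j v t'.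
Proof.
move=> tt'; case: j => [[-> nt]|j [v0 [t0 [ch le_t0 ->]]]] /=.
  by split=> //; apply: le_trans tt'.
by exists v0, t0; split=> //; apply: le_trans tt'.
Qed.

(** Delaying each exit level to the [r] of [gap_switch] cancels the bullets of all rows but the
    last. *)
Lemma chain_slide n M j v t : (j < a)%N -> t <= M -> chain n (M + 1) j v t ->
  exists2 v', chain n M j v' t & v <= v' + bullet t M j.
Proof.
elim: j v t => [|j IHj] v t ja tM /=.
  case=> -> nt; exists (rowlen n M 0)%:Z => //.
  by have := bullet_row0 ja nt tM; rewrite /bullet; lia.
case=> v0 [t0 [ch t0t ->]].
have [v' ch' le_v] := IHj _ _ (ltnW ja) (le_trans t0t tM) ch.
have [r [t0r rt le_gap]] := gap_switch ja t0t tM.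
exists (v' - gap r M j).
  by exists v', r; split=> //; apply: chain_le ch'.
by move: le_v le_gap; rewrite /gap /bullet; lia.
Qed.

Lemma chain_diag n m j v t : (j < a)%N -> chain n m j v t -> v <= rowlen n m 0.
Proof.
elim: j v t => [|j IHj] v t ja /=; first by case=> ->.
case=> v0 [t0 [/(IHj _ _ (ltnW ja)) le_v0 _ ->]].
by have := rowlen_row t0 m ja; rewrite /gap; lia.
Qed.

(** Slide from column [M] to [m]: the bullets of row [j] at level [m] telescope. *)
Lemma chain_bound n m M j v : (j < a)%N -> m <= M -> chain n M j v m ->
  v <= rowlen n m 0 + rowlen m M j.
Proof.
move=> ja mM; have [k ->] : exists k : nat, M = m + k%:Z by exists `|M - m|%N; lia.
elim: k v => [|k IHk] v.
  by rewrite addr0 => /(chain_diag ja); lia.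
have -> : m + k.+1%:Z = m + k%:Z + 1 by lia.
case/(chain_slide ja) => [|v' /IHk le_v']; first lia.
by rewrite /bullet; lia.
Qed.

(** Every row is left at level [n], and the gaps telescope. *)
Lemma chain_last n M j : chain n M j (rowlen n M j) n.
Proof.
elim: j => [|j IHj] //=; exists (rowlen n M j)%:Z, n.
by split=> //; rewrite /gap; lia.
Qed.

Lemma rowlen_weyl n m M j : (j < a)%N -> n <= m -> m <= M ->
  (rowlen n M j <= rowlen n m 0 + rowlen m M j)%N.
Proof.
move=> ja nm mM.
have := chain_bound ja mM (chain_le nm (chain_last n M j)); lia.
Qed.

Lemma not_both_out N y z N' y' z' : (y < b)%N -> 0 <= z -> z < c%:Z ->
  (0 < a)%N ->
  y' = (b.-1 - y)%N -> z' = c%:Z - 1 - z ->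
  N' = N + (a + b + c)%:Z - 2 - y%:Z - z ->
  ~~ f N' a.-1 y' z' -> f N 0 y z.
Proof.
move=> yb z0 zc a0 -> -> -> out.
(* The face point is box [(0, y)] of [L(n, m)], its antipode is box [(a - 1, b - 1 - y)] of
   [L(m, M)], and [L(n, M)] is full. *)
pose n := N - y%:Z; pose m := N + c%:Z - z; pose M := n + (a + b + c)%:Z - 1.
have a1a : (a.-1 < a)%N by lia.
have := @rowlen_weyl n m M a.-1 a1a ltac:(lia) ltac:(lia).
rewrite rowlen_full //; [|lia|lia].
have : ~~ (b.-1 - y < rowlen m M a.-1)%N.
  rewrite rowlenE // negb_and; apply/orP; right; apply: contra out.
  by rewrite /growth; congr (f _ _ _ _); lia.
move=> le1 le2; have : (y < rowlen n m 0)%N by lia.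
rewrite rowlenE // => /andP[_]; rewrite /growth.
by congr (f _ _ _ _); lia.
Qed.

End Growth.

(** * Symmetries, reciprocity and periodicity of the face *)

Lemma spacetime_dual f : spacetime f ->
  spacetime (fun N x y z => ~~ f (- N) (a.-1 - x)%N (b.-1 - y)%N (c%:Z - 1 - z)).
Proof.
move=> fP; split.
- by move=> N x y z xa yb z0; apply: (st_high fP); lia.
- by move=> N x y z xa yb cz; rewrite negbK; apply: (st_low fP); lia.
- move=> N x y z N' x' y' z' nf x'a y'b cov NN'; apply: contra nf => h.
  by apply: (st_down fP h); move: cov; rewrite /covers; lia.
- move=> N x y z xa yb zc; rewrite !negbK => f0 f1.
  have eN : - N = - (N + 1) + 1 by lia.
  rewrite eN in f0.
  have [x' [y' [z' [cov [x'a y'b h]]]]] :=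
    st_in fP (ltac:(lia) : a.-1 - x < a)%N (ltac:(lia) : b.-1 - y < b)%N
      (ltac:(lia) : 0 <= c%:Z - 1 - z) f1 f0.
  exists (a.-1 - x')%N, (b.-1 - y')%N, (c%:Z - 1 - z'); split.
    by move: cov; rewrite /covers; lia.
  rewrite negbK eN.
  by move: h; congr (is_true (f _ _ _ _)); lia.
- move=> N x y z xa yb z0 f0 f1.
  have eN : - N = - (N + 1) + 1 by lia.
  rewrite eN in f0.
  have [x' [y' [z' [cov nf]]]] :=
    st_out fP (ltac:(lia) : a.-1 - x < a)%N (ltac:(lia) : b.-1 - y < b)%N
      (ltac:(lia) : c%:Z - 1 - z < c%:Z) f1 f0.
  exists (a.-1 - x')%N, (b.-1 - y')%N, (c%:Z - 1 - z').
  have [x'a y'b] : (x' < a)%N /\ (y' < b)%N by move: cov; rewrite /covers; lia.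
  split; first by move: cov; rewrite /covers; lia.
  split; [lia|lia|].
  by move: nf; congr (is_true (~~ f _ _ _ _)); lia.
Qed.

(** Rank rises by one along a cover, so the two time steps 0 and 1 of the local rule are
    exchanged. *)
Lemma spacetime_reverse f : spacetime f ->
  spacetime (fun N x y z => f (x%:Z + y%:Z + z - N) x y z).
Proof.
move=> fP; split.
- by move=> N x y z xa yb z0; apply: (st_low fP).
- by move=> N x y z xa yb cz; apply: (st_high fP).
- move=> N x y z N' x' y' z' h x'a y'b cov NN'.
  by apply: (st_down fP h) => //; move: cov NN'; rewrite /covers; lia.
- move=> N x y z xa yb zc f1 f0.
  have e : x%:Z + y%:Z + z - N = x%:Z + y%:Z + z - (N + 1) + 1 by lia.
  rewrite e in f1; have [x' [y' [z' [cov nf]]]] := st_out fP xa yb zc f0 f1.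
  exists x', y', z'; split=> //.
  by move: nf; congr (is_true (~~ f _ _ _ _)); move: cov; rewrite /covers; lia.
- move=> N x y z xa yb z0 f1 f0.
  have e : x%:Z + y%:Z + z - N = x%:Z + y%:Z + z - (N + 1) + 1 by lia.
  rewrite e in f1.
  have [x' [y' [z' [cov [x'a y'b h]]]]] := st_in fP xa yb z0 f0 f1.
  exists x', y', z'; split=> //; split=> //.
  by move: h; congr (is_true (f _ _ _ _)); move: cov; rewrite /covers; lia.
Qed.

(** One implication is [not_both_out] for [f], the other is the same for its dual. *)
Lemma reciprocity f N y z N' y' z' : spacetime f -> (0 < a)%N ->
  (y < b)%N -> 0 <= z -> z < c%:Z ->
  y' = (b.-1 - y)%N -> z' = c%:Z - 1 - z ->
  N' = N + (a + b + c)%:Z - 2 - y%:Z - z ->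
  f N 0 y z = ~~ f N' a.-1 y' z'.
Proof.
move=> fP a0 yb z0 zc ey ez eN; apply/idP/idP; last first.
  exact: (not_both_out fP yb z0 zc a0 ey ez eN).
have := @not_both_out _ (spacetime_dual fP) (- N') y z (- N) y' z'
  yb z0 zc a0 ey ez.
move=> /(_ ltac:(lia)) h f0; have {}h : ~~ ~~ f N 0 y z -> ~~ f N' a.-1 y' z'.
  move=> nf; have : ~~ f (- - N') (a.-1 - 0)%N (b.-1 - y)%N (c%:Z - 1 - z).
    apply: h; move: nf; congr (is_true (~~ ~~ f _ _ _ _)); lia.
  by congr (is_true (~~ f _ _ _ _)); lia.
by apply: h; rewrite negbK.
Qed.

Lemma face_periodic f N y z : spacetime f -> (0 < a)%N ->
  (y < b)%N -> 0 <= z -> z < c%:Z ->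
  f (N + (a + b + c)%:Z - 1) 0 y z = f N 0 y z.
Proof.
move=> fP a0 yb z0 zc.
rewrite (@reciprocity f N y z _ _ _ fP a0 yb z0 zc erefl erefl erefl).
(* At this reversed time, the face point at [N + q] is paired with the same antipodal event as the
   face point at [N]. *)
have := @reciprocity _ (y%:Z + z - (N + (a + b + c)%:Z - 1)) y z _ _ _
  (spacetime_reverse fP) a0 yb z0 zc erefl erefl erefl.
rewrite (_ : _ - (y%:Z + z - (N + (a + b + c)%:Z - 1)) = N + (a + b + c)%:Z - 1).
  by move=> ->; congr (~~ f _ _ _ _); lia.
lia.
Qed.

Lemma face_not_constant f : spacetime f -> (0 < a)%N -> (0 < b)%N -> (0 < c)%N ->
  ~ (forall N y z, (y < b)%N -> 0 <= z -> z < c%:Z ->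
      f (N + 1) 0 y z = f N 0 y z).
Proof.
move=> fP a0 b0 c0 cst.
(* A constant face is full: a point staying outside would have a lower neighbour outside, again on
   the face. *)
have face k : forall N y z, (y < b)%N -> z < c%:Z -> y%:Z + z < k%:Z -> f N 0 y z.
  elim: k => [|k IHk] N y z yb zc yzk.
    by apply: (st_low fP) => //; lia.
  apply/negPn/negP => nf; have [z0|z0] := ltP z 0.
    by rewrite (st_low fP) in nf.
  have [x' [y' [z' [cov]]]] := st_out fP a0 yb zc nf ltac:(by rewrite cst).
  have [-> y'b z'c lt_k] :
      [/\ x' = 0%N, (y' < b)%N, z' < c%:Z & y'%:Z + z' < k%:Z].
    by move: cov; rewrite /covers; split; lia.
  by rewrite IHk.
have out N : ~~ f N a.-1 0 0.
  have := @reciprocity f (N - a%:Z) b.-1 (c%:Z - 1) _ _ _ fP a0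
    (ltac:(lia) : b.-1 < b)%N (ltac:(lia) : 0 <= c%:Z - 1)
    (ltac:(lia) : c%:Z - 1 < c%:Z) erefl erefl erefl.
  rewrite (face (b + c)%N); [|lia|lia|lia] => /esym.
  by congr (is_true (~~ f _ _ _ _)); lia.
(* A point of the [x]-axis that is always outside forces its predecessor on that axis to be always
   outside. *)
have {}out k : forall N, ~~ f N (a.-1 - k)%N 0 0.
  elim: k => [|k IHk] N; first by rewrite subn0.
  have [ak|ak] := leqP a.-1 k.
    by have := IHk N; congr (is_true (~~ f _ _ _ _)); lia.
  have [x' [y' [z' [cov]]]] :=
    st_out fP (ltac:(lia) : a.-1 - k < a)%N b0 (ltac:(lia) : 0 < c%:Z)
      (IHk N) (IHk (N + 1)).
  have [x'a ->] : (x' < a)%N /\ y' = 0%N by move: cov; rewrite /covers; lia.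
  have [z0|z0] := ltP z' 0; first by rewrite (st_low fP).
  by congr (is_true (~~ f _ _ _ _)); move: cov; rewrite /covers; lia.
by have := out a.-1 0; rewrite subnn (face 1%N).
Qed.

End Spacetime.

(** * Rowmotion on a box as a spacetime *)

Section RowmotionOrder.

Context {d : Order.disp_t} (P : finPOrderType d).
Implicit Types (I : order_ideal P) (p q : P).

Lemma order_ideal_le I p q : q \in (I : {set P}) -> (p <= q)%O ->
  p \in (I : {set P}).
Proof.
move=> qI pq.
by have /forall_inP/(_ _ qI)/forallP/(_ p)/implyP := ideal_setP I; apply.
Qed.

Lemma mem_rowmotion I p : p \in (rowmotion I : {set P}) ->
  exists2 g, (p <= g)%O & g \in minimal_elements (~: I).
Proof. by rewrite inE => /exists_inP[g gm pg]; exists g. Qed.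

Lemma rowmotion_lt I p q :
  q \in (rowmotion I : {set P}) -> (p < q)%O -> p \in (I : {set P}).
Proof.
case/mem_rowmotion => g qg; rewrite inE => /andP[_ /forall_inP gmin] pq.
apply/negPn/negP => pI; have := gmin p; rewrite inE => /(_ pI).
by rewrite (lt_le_trans pq qg).
Qed.

Lemma rowmotion_out I p :
  p \notin (I : {set P}) -> p \notin (rowmotion I : {set P}) ->
  exists2 g, (g < p)%O & g \notin (I : {set P}).
Proof.
move=> pI pR.
have [/exists_inP[g]|] := boolP [exists g in ~: (I : {set P}), (g < p)%O].
  by rewrite inE => gI gp; exists g.
rewrite negb_exists_in => pmin; case/negP: pR; rewrite inE.
by apply/exists_inP; exists p => //; rewrite !inE pI.
Qed.

Lemma rowmotion_in I p : p \in (I : {set P}) -> p \in (rowmotion I : {set P}) ->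
  exists2 g, (p < g)%O & g \in (rowmotion I : {set P}).
Proof.
move=> pI /mem_rowmotion[g]; rewrite le_eqVlt => /orP[/eqP <-|pg gm].
  by rewrite !inE pI.
by exists g => //; rewrite inE; apply/exists_inP; exists g.
Qed.

End RowmotionOrder.

Section Box.

Variables a b c : nat.
Implicit Types I : J(box a b c).

Definition cx (p : box a b c) : nat := p.1.1.
Definition cy (p : box a b c) : nat := p.1.2.
Definition cz (p : box a b c) : nat := p.2.

Lemma cx_lt p : cx p < a. Proof. exact: ltn_ord. Qed.
Lemma cy_lt p : cy p < b. Proof. exact: ltn_ord. Qed.
Lemma cz_lt p : cz p < c. Proof. exact: ltn_ord. Qed.

Definition in_ideal I x y (z : int) : bool :=
  (z < 0)%R ||
  [exists p in (I : {set box a b c}),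
     [&& cx p == x, cy p == y & Posz (cz p) == z]].

Lemma le_box (p q : box a b c) :
  (p <= q)%O = [&& (cx p <= cx q)%N, (cy p <= cy q)%N & (cz p <= cz q)%N].
Proof. by rewrite !Order.ProdOrder.leEprod andbA. Qed.

Lemma lt_box (p q : box a b c) : (p < q)%O ->
  [/\ cx p <= cx q, cy p <= cy q & cz p <= cz q] /\
  [|| cx p < cx q, cy p < cy q | cz p < cz q].
Proof.
rewrite lt_leAnge !le_box => /andP[/and3P[-> -> ->]].
by rewrite !negb_and -!ltnNge.
Qed.

Lemma in_ideal_ge I (q : box a b c) x y (z : int) : q \in (I : {set _}) ->
  x <= cx q -> y <= cy q -> (z <= Posz (cz q))%R -> in_ideal I x y z.
Proof.
move=> qI xq yq zq; rewrite /in_ideal; case: ltP => //= z0.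
have xa := leq_ltn_trans xq (cx_lt q).
have yb := leq_ltn_trans yq (cy_lt q).
have [zc zq'] : `|z|%N < c /\ `|z|%N <= cz q by have := cz_lt q; lia.
apply/exists_inP.
exists ((Ordinal xa, Ordinal yb, Ordinal zc) : ('I_a * 'I_b * 'I_c)%type).
  by apply: order_ideal_le qI _; rewrite le_box /= xq yq.
by rewrite /cx /cy /cz /= !eqxx; apply/eqP; lia.
Qed.

Lemma in_ideal_le I (p : box a b c) x y (z : int) : in_ideal I x y z ->
  cx p <= x -> cy p <= y -> (Posz (cz p) <= z)%R -> p \in (I : {set _}).
Proof.
move=> inI px py pz; case/orP: inI => [z0|]; first lia.
case/exists_inP => q qI /and3P[/eqP qx /eqP qy /eqP qz].
by apply: order_ideal_le qI _; rewrite le_box qx qy px py /=; lia.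
Qed.

Lemma in_idealP I x y (z : int) : (0 <= z)%R -> in_ideal I x y z ->
  exists p : box a b c,
    [/\ p \in (I : {set _}), x = cx p, y = cy p & z = Posz (cz p)].
Proof.
move=> z0; rewrite /in_ideal ltNge z0.
by case/exists_inP => p pI /and3P[/eqP <- /eqP <- /eqP <-]; exists p.
Qed.

Lemma box_point x y (z : int) : x < a -> y < b -> (0 <= z)%R -> (z < Posz c)%R ->
  exists p : box a b c, [/\ x = cx p, y = cy p & z = Posz (cz p)].
Proof.
move=> xa yb z0 zc; have zc' : `|z|%N < c by lia.
exists ((Ordinal xa, Ordinal yb, Ordinal zc') : ('I_a * 'I_b * 'I_c)%type).
by split=> //; rewrite /cz /=; lia.
Qed.

Lemma spacetime_rowmotion (g : int -> J(box a b c)) :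
  (forall N, g (N + 1)%R = rowmotion (g N)) ->
  spacetime a b c (fun N => in_ideal (g N)).
Proof.
move=> gS; split.
- by move=> N x y z _ _ z0; rewrite /in_ideal z0.
- move=> N x y z _ _ cz; apply/negP => /in_idealP[|p [_ _ _ ez]]; first lia.
  by have := cz_lt p; lia.
- move=> N x y z N' x' y' z' h x'a y'b cov NN'.
  have [z0|z0] := ltP z 0%R; first by rewrite /in_ideal z0.
  have [|q [qI ex ey ez]] := in_idealP _ h; first by case: cov; lia.
  have zc : (z < Posz c)%R by have := cz_lt q; case: cov; lia.
  have [||p [px py pz]] := box_point (x := x) (y := y) _ _ z0 zc.
  + by case: cov; lia.
  + by case: cov; lia.
  have pq : (p < q)%O.
    rewrite lt_leAnge !le_box; move: cov; rewrite px py pz ex ey ez /covers; lia.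
  suff pI : p \in (g N : {set _}) by apply: (in_ideal_ge pI); lia.
  case: NN' qI => ->; first by move=> qI; apply: order_ideal_le qI (ltW pq).
  by rewrite gS => qI; apply: rowmotion_lt qI pq.
- move=> N x y z xa yb zc nf0 nf1.
  have z0 : (0 <= z)%R by move: nf0; rewrite /in_ideal; case: ltP.
  have [p [px py pz]] := box_point xa yb z0 zc.
  have notin I : ~~ in_ideal I x y z -> p \notin (I : {set _}).
    by apply: contra => pI; apply: (in_ideal_ge pI); lia.
  have pI := notin _ nf0; have := notin _ nf1; rewrite gS => pR.
  have [q /lt_box[[qx qy qz] lt_qp] qI] := rowmotion_out pI pR.
  have {}notin x' y' z' : cx q <= x' -> cy q <= y' -> (Posz (cz q) <= z')%R ->
      ~~ in_ideal (g N) x' y' z'.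
    by move=> qx' qy' qz'; apply: contra qI => /in_ideal_le; apply.
  (* [q] need not be covered by [p]: lower [p] by one in a coordinate where [q] is smaller; the
     result is still above [q], hence outside. *)
  case/or3P: lt_qp => lt_qp.
  + by exists x.-1, y, z; split; [rewrite /covers; lia|apply: notin; lia].
  + by exists x, y.-1, z; split; [rewrite /covers; lia|apply: notin; lia].
  + by exists x, y, (z - 1)%R; split; [rewrite /covers; lia|apply: notin; lia].
- move=> N x y z xa yb z0 /(in_idealP z0)[p [pI px py pz]] f1.
  have pR : p \in (rowmotion (g N) : {set _}).
    by rewrite -gS; apply: (in_ideal_le f1); lia.
  have [q /lt_box[[qx qy qz] lt_pq]] := rowmotion_in pI pR; rewrite -gS => qI.
  have qa := cx_lt q; have qb := cy_lt q.
  case/or3P: lt_pq => lt_pq.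
  + exists x.+1, y, z; split; first by rewrite /covers; lia.
    by split; [lia|lia|apply: (in_ideal_ge qI); lia].
  + exists x, y.+1, z; split; first by rewrite /covers; lia.
    by split; [lia|lia|apply: (in_ideal_ge qI); lia].
  + exists x, y, (z + 1)%R; split; first by rewrite /covers; lia.
    by split; [lia|lia|apply: (in_ideal_ge qI); lia].
Qed.

End Box.

(** * Coprime periods and the conclusion *)

Lemma coprime_periods (T : Type) (h : int -> T) k q : 0 < k -> coprime k q ->
  (forall N, h (N + Posz k)%R = h N) -> (forall N, h (N + Posz q)%R = h N) ->
  forall N, h (N + 1)%R = h N.
Proof.
have per m : (forall N, h (N + Posz m)%R = h N) ->
    forall i N, h (N + Posz (i * m))%R = h N.
  move=> hm; elim=> [|i IHi] N; first by rewrite mul0n addr0.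
  by rewrite mulSn PoszD addrA IHi hm.
(* Bezout: [u * k = v * q + 1]. *)
move=> k0 /eqP kq hk hq N; case: (egcdnP q k0) => u v e _.
rewrite -(per k hk u N) -(per q hq v (N + 1)%R).
by rewrite e kq; congr h; lia.
Qed.

Theorem theorem1p3 (a b c : nat) (ha : 0 < a) (hb : 0 < b) (hc : 0 < c)
    (I : J(box a b c)) :
  1 < gcdn #|orbit (@rowmotion _ (box a b c)) I| (a + b + c - 1).
Proof.
set Psi := @rowmotion _ _; set q := a + b + c - 1.
have -> : #|orbit Psi I| = order Psi I.
  by rewrite (card_uniqP (orbit_uniq _ _)) size_orbit.
set k := order Psi I; have k0 : 0 < k := order_gt0 _ _.
have iter_k : iter k Psi I = I by apply/iter_order/rowmotion_inj.
rewrite ltn_neqAle eq_sym gcdn_gt0 k0 andbT; apply/negP => kq.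
(* Reduction modulo [k] extends the orbit to negative times. *)
pose g (N : int) := iter `|(N %% k)%Z|%N Psi I.
have gS N : g (N + 1)%R = Psi (g N).
  have kn0 : Posz k != 0%R by rewrite eqz_nat -lt0n.
  rewrite /g -iterS -modzDml; have := ltz_pmod N (k0 : (0 < Posz k)%R).
  case: (N %% k)%Z (modz_ge0 N kn0) => // r _; rewrite ltz_nat -PoszD addn1.
  rewrite modz_nat absz_nat leq_eqVlt => /orP[/eqP ->|/modn_small -> //].
  by rewrite modnn.
have gk N : g (N + Posz k)%R = g N by rewrite /g modzDr.
have st := spacetime_rowmotion gS.
apply: (face_not_constant st ha hb hc) => N y z yb z0 zc.
apply: (@coprime_periods _ (fun N => in_ideal (g N) 0 y z) k q) => // {}N.
  by rewrite gk.
by rewrite -(face_periodic N st ha yb z0 zc); congr (in_ideal (g _) _ _ _); lia.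
Qed.
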